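(* Let $\Bbbk$ be a field, let $S$ be a Noetherian positively graded $\Bbbk$-algebra, let $M$ be a finite graded $S$-module, and set $\mathfrak n=(S_1)S$, the ideal of $S$ generated by $S_1$. If $I\subseteq\operatorname{tr}_S(M)$ is a graded ideal of $S$, then $$\operatorname{tr}_{S^{(d)}}(M^{(d)})\supseteq(\mathfrak n^{d-1}I)^{(d)}$$ for every integer $d\ge1$.
   Context: A positively graded $\Bbbk$-algebra is a (commutative) Noetherian graded $\Bbbk$-algebra $S=\bigoplus_{i\ge0}S_i$ with $\dim_\Bbbk S_0<\infty$. For a graded $S$-module $M$ and $d\ge1$, $M^{(d)}=\bigoplus_{j\in\mathbb Z}M_{jd}$, regraded so that $M_{jd}$ sits in degree $j$; $S^{(d)}=\bigoplus_{i\ge0}S_{id}$ is the $d$-th Veronese subalgebra and $M^{(d)}$ is a graded $S^{(d)}$-module. The trace of a finite graded $S$-module $M$ is the ideal $\operatorname{tr}_S(M)=\sum_{\varphi\in\operatorname{Hom}_S(M,S)}\varphi(M)$. By convention $\mathfrak n^0=S$. *)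

(* Defs.v *)
From HB Require Import structures.
From mathcomp Require Import all_boot all_algebra.
From mathcomp Require Import boolp classical_sets.

Set Implicit Arguments.
Unset Strict Implicit.
Unset Printing Implicit Defensive.

Import GRing.Theory.
Local Open Scope classical_set_scope.
Local Open Scope ring_scope.

Section Submodules.
Variables (R : pzRingType) (V : lmodType R).

Definition is_submodule (N : set V) : Prop := submod_closed [in N].

Definition submod_gen (A : set V) : set V := smallest is_submodule A.

Definition finitely_generated (N : set V) : Prop :=
  exists s : seq V, N = submod_gen [set` s].

(* The homomorphisms are all R-linear maps V -> R, not only the graded ones. *)
Definition trace : set R :=
  [set x | exists s : seq ({scalar V} * V), x = \sum_(p <- s) p.1 p.2].

End Submodules.
Arguments finitely_generated R {V} N.
Arguments trace {R} V.

Section Ideals.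
Variable R : comPzRingType.

Definition is_ideal (I : set R) : Prop := @is_submodule R R^o I.

Definition ideal_gen (A : set R) : set R := @submod_gen R R^o A.

Definition noetherian : Prop :=
  forall I : set R, is_ideal I -> @finitely_generated R R^o I.

Definition ideal_mul (I J : set R) : set R :=
  ideal_gen [set z | exists x y, [/\ I x, J y & z = x * y]].

Fixpoint ideal_exp (I : set R) (n : nat) : set R :=
  if n is m.+1 then ideal_mul I (ideal_exp I m) else [set: R].

End Ideals.
Arguments noetherian : clear implicits.

Section InternalSums.
Variables (J : eqType) (V : zmodType) (W : J -> set V).

Definition internal_sum : set V :=
  [set x | exists (s : seq J) (f : J -> V),
     (forall j, W j (f j)) /\ x = \sum_(j <- s) f j].

Definition independent : Prop :=
  forall (s : seq J) (f : J -> V), uniq s -> (forall j, W j (f j)) ->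
    \sum_(j <- s) f j = 0 -> forall j, j \in s -> f j = 0.

End InternalSums.

(* The k-algebra structure is a ring morphism k -> S on a comPzRingType, and not
   a comAlgType k, because the latter excludes the zero ring. *)
HB.mixin Record isGradedAlg (k : fieldType) S of GRing.ComPzRing S := {
  algmap : {rmorphism k -> S};
  hcomp : nat -> set S;
  hcomp0 : forall i, hcomp i 0;
  hcompB : forall i x y, hcomp i x -> hcomp i y -> hcomp i (x - y);
  hcompZ : forall i (a : k) x, hcomp i x -> hcomp i (algmap a * x);
  hcomp1 : hcomp 0%N 1;
  hcompM : forall i j x y,
    hcomp i x -> hcomp j y -> hcomp (i + j)%N (x * y);
  hcomp_sum : internal_sum hcomp = [set: S];
  hcomp_indep : independent hcomp
}.

#[short(type="gradedAlgType")]
HB.structure Definition GradedAlg (k : fieldType) :=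
  {S of GRing.ComPzRing S & isGradedAlg k S}.

(* S as a k-vector space through algmap *)
Definition kspace (k : fieldType) (S : gradedAlgType k) : Type := S.

Section KSpace.
Variables (k : fieldType) (S : gradedAlgType k).

HB.instance Definition _ := GRing.Zmodule.on (kspace S).

Let scale (a : k) (x : kspace S) : kspace S := (algmap a : S) * (x : S).

Let scaleA a b x : scale a (scale b x) = scale (a * b) x.
Proof. by rewrite /scale rmorphM mulrA. Qed.

Let scale1 : left_id 1 scale.
Proof. by move=> x; rewrite /scale rmorph1 mul1r. Qed.

Let scaleDr : right_distributive scale +%R.
Proof. by move=> a x y; rewrite /scale mulrDr. Qed.

Let scaleDl x : {morph scale^~ x : a b / a + b}.
Proof. by move=> a b; rewrite /scale rmorphD mulrDl. Qed.

HB.instance Definition _ := GRing.Zmodule_isLmodule.Build k (kspace S)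
  scaleA scale1 scaleDr scaleDl.

End KSpace.

HB.mixin Record isGradedMod (k : fieldType) (S : gradedAlgType k) M
    of GRing.Lmodule S M := {
  mcomp : int -> set M;
  mcomp0 : forall j, mcomp j 0;
  mcompB : forall j u v, mcomp j u -> mcomp j v -> mcomp j (u - v);
  mcompZ : forall i j (a : S) (u : M),
    hcomp i a -> mcomp j u -> mcomp (i%:Z + j) (a *: u);
  mcomp_sum : internal_sum mcomp = [set: M];
  mcomp_indep : independent mcomp
}.

#[short(type="gradedModType")]
HB.structure Definition GradedMod (k : fieldType) (S : gradedAlgType k) :=
  {M of GRing.Lmodule S M & isGradedMod k S M}.

Definition graded_ideal (k : fieldType) (S : gradedAlgType k) (I : set S) :=
  is_ideal I /\ I `<=` internal_sum (fun i => I `&` hcomp i).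

Section InternalSumTheory.
Variables (J : eqType) (V : zmodType) (W : J -> set V).
Hypothesis W0 : forall j, W j 0.
Hypothesis WB : forall j u v, W j u -> W j v -> W j (u - v).

Lemma internal_sum_seq (T : Type) (s : seq T) (g : T -> J) (f : T -> V) :
  (forall t, W (g t) (f t)) -> internal_sum W (\sum_(t <- s) f t).
Proof.
have WD j u v : W j u -> W j v -> W j (u + v).
  move=> Wu Wv; rewrite -[v]opprK; apply: WB => //.
  by rewrite -[- v]add0r; apply: WB.
move=> Wf.
exists (undup (map g s)).
exists (fun j => \sum_(t <- s | g t == j) f t); split=> [j|].
  by apply: big_ind => // [u v|t /eqP<-//]; exact: WD.
have : {subset map g s <= undup (map g s)} by move=> j; rewrite mem_undup.
elim: s (undup _) (undup_uniq (map g s)) => [|x s IHs] r ur rP.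
  by rewrite big_nil big1// => j _; rewrite big_nil.
have gr : g x \in r by apply: rP; exact: mem_head.
rewrite big_cons (IHs r) //; last by move=> j js; apply: rP; exact: mem_behead.
under [RHS]eq_bigr => j _ do rewrite big_cons.
rewrite [RHS](bigD1_seq (g x)) //= eqxx (bigD1_seq (g x)) //=.
rewrite addrA; congr (_ + _); apply: eq_bigr => j.
by rewrite eq_sym => /negPf->.
Qed.

Lemma internal_sum_incl j u : W j u -> internal_sum W u.
Proof.
move=> Wu; have := @internal_sum_seq unit [:: tt] (fun=> j) (fun=> u).
by rewrite big_seq1; apply.
Qed.

Lemma internal_sum0 : internal_sum W 0.
Proof. by exists [::], (fun=> 0); rewrite big_nil. Qed.

Lemma internal_sumB u v :
  internal_sum W u -> internal_sum W v -> internal_sum W (u - v).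
Proof.
move=> [s [f [Wf ->]]] [t [g [Wg ->]]].
pose h (x : J + J) := match x with inl j => f j | inr j => - g j end.
have -> : \sum_(j <- s) f j - \sum_(j <- t) g j =
    \sum_(x <- map inl s ++ map inr t) h x.
  by rewrite big_cat !big_map /= sumrN.
apply: (@internal_sum_seq _ _ (fun x => match x with inl j | inr j => j end)).
by case=> j //=; rewrite -[- _]add0r; apply: WB.
Qed.

Lemma internal_sum_big (T : Type) (s : seq T) (f : T -> V) :
  (forall t, internal_sum W (f t)) -> internal_sum W (\sum_(t <- s) f t).
Proof.
move=> Wf; apply: big_ind => //; first exact: internal_sum0.
move=> u v Wu Wv; rewrite -[v]opprK; apply: internal_sumB => //.
by rewrite -[- v]add0r; apply: internal_sumB => //; exact: internal_sum0.
Qed.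

End InternalSumTheory.

Section VeroneseAlg.
Variables (k : fieldType) (S : gradedAlgType k) (d : nat) (d_gt0 : (0 < d)%N).

Definition veronese_alg_set : set S := internal_sum (fun j => hcomp (j * d)%N).

Let B0 j : hcomp (j * d)%N (0 : S). Proof. exact: hcomp0. Qed.
Let BB j (u v : S) :
  hcomp (j * d)%N u -> hcomp (j * d)%N v -> hcomp (j * d)%N (u - v).
Proof. exact: hcompB. Qed.

Lemma veronese_alg_setM x y :
  veronese_alg_set x -> veronese_alg_set y -> veronese_alg_set (x * y).
Proof.
move=> [s [f [Wf ->]]] [t [g [Wg ->]]].
rewrite big_distrl; apply: (internal_sum_big B0 BB) => i /=.
rewrite big_distrr; apply: (internal_sum_big B0 BB) => j /=.
by apply: (internal_sum_incl B0 BB (j := (i + j)%N)); rewrite mulnDl; apply: hcompM.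
Qed.

Lemma veronese_subring_closed : subring_closed [in veronese_alg_set].
Proof.
split=> [|x y|x y]; rewrite !inE.
- by apply: (internal_sum_incl B0 BB (j := 0%N)); exact: hcomp1.
- exact: (internal_sumB B0 BB).
- exact: veronese_alg_setM.
Qed.

(* The proof of 0 < d is an argument because the pieces S_(jd) are not
   independent when d = 0. *)
Definition veronese_alg of (0 < d)%N : Type := {x : S | [in veronese_alg_set] x}.

Local Notation Sd := (veronese_alg d_gt0).

HB.instance Definition _ := [isSub of Sd for @sval _ _].
HB.instance Definition _ := [Choice of Sd by <:].
HB.instance Definition _ :=
  GRing.SubChoice_isSubComPzRing.Build S [in veronese_alg_set] Sd veronese_subring_closed.

Fact veronese_algmap_subproof (a : k) : (algmap a : S) \in veronese_alg_set.
Proof.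
rewrite inE; apply: (internal_sum_incl B0 BB (j := 0%N)).
by rewrite -[algmap a]mulr1; apply: hcompZ; exact: hcomp1.
Qed.

Definition veronese_algmap (a : k) : Sd := Sub (algmap a) (veronese_algmap_subproof a).

Fact veronese_algmapB : zmod_morphism veronese_algmap.
Proof. by move=> a b; apply: val_inj; rewrite raddfB !SubK raddfB. Qed.

Fact veronese_algmapM : monoid_morphism veronese_algmap.
Proof.
split=> [|a b]; apply: val_inj; first by rewrite SubK !rmorph1.
by rewrite rmorphM !SubK rmorphM.
Qed.

HB.instance Definition _ := GRing.isZmodMorphism.Build k Sd veronese_algmap veronese_algmapB.
HB.instance Definition _ := GRing.isMonoidMorphism.Build k Sd veronese_algmap veronese_algmapM.

Definition veronese_alg_comp (j : nat) : set Sd := [set x | hcomp (j * d)%N (val x)].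

Fact veronese_alg_comp0 j : veronese_alg_comp j 0.
Proof. by rewrite /veronese_alg_comp /mkset raddf0; exact: hcomp0. Qed.

Fact veronese_alg_compB j x y : veronese_alg_comp j x -> veronese_alg_comp j y ->
  veronese_alg_comp j (x - y).
Proof. by rewrite /veronese_alg_comp /mkset raddfB; exact: hcompB. Qed.

Fact veronese_alg_compZ j (a : k) x : veronese_alg_comp j x ->
  veronese_alg_comp j (veronese_algmap a * x).
Proof. by rewrite /veronese_alg_comp /mkset rmorphM; exact: hcompZ. Qed.

Fact veronese_alg_comp1 : veronese_alg_comp 0 1.
Proof. by rewrite /veronese_alg_comp /mkset rmorph1; exact: hcomp1. Qed.

Fact veronese_alg_compM i j x y : veronese_alg_comp i x -> veronese_alg_comp j y ->
  veronese_alg_comp (i + j)%N (x * y).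
Proof. by rewrite /veronese_alg_comp /mkset rmorphM mulnDl; exact: hcompM. Qed.

Fact veronese_alg_comp_sum : internal_sum veronese_alg_comp = [set: Sd].
Proof.
rewrite -subTset => x _; have := valP x; rewrite inE => -[s [f [Wf xE]]].
have fP j : f j \in veronese_alg_set.
  by rewrite inE; exact: (internal_sum_incl B0 BB (j := j)).
exists s, (fun j => Sub (f j) (fP j) : Sd); split=> [j|].
  by rewrite /veronese_alg_comp /mkset SubK.
by apply: val_inj; rewrite raddf_sum [LHS]xE.
Qed.

Fact veronese_alg_comp_indep : independent veronese_alg_comp.
Proof.
move=> s f us Wf s0 j js; apply: val_inj; rewrite raddf0.
have inj : injective (fun i => i * d)%N.
  by move=> a b /eqP; rewrite eqn_pmul2r // => /eqP.
pose g i := if (d %| i)%N then val (f (i %/ d)%N) else 0.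
have gE i : g (i * d)%N = val (f i) by rewrite /g dvdn_mull // mulnK.
rewrite -gE; apply: (@hcomp_indep k S (map (fun i => i * d)%N s) g).
- by rewrite map_inj_uniq.
- move=> i; rewrite /g; case: ifP => [/dvdnP[a ->]|_]; last exact: hcomp0.
  by rewrite mulnK //; exact: Wf.
- rewrite big_map; under eq_bigr => i _ do rewrite gE.
  by rewrite -raddf_sum s0 raddf0.
- exact: map_f.
Qed.

HB.instance Definition _ := isGradedAlg.Build k Sd veronese_alg_comp0
  veronese_alg_compB veronese_alg_compZ veronese_alg_comp1 veronese_alg_compM
  veronese_alg_comp_sum veronese_alg_comp_indep.

Definition veronese_ideal (I : set S) : set Sd :=
  [set x | internal_sum (fun j => I `&` hcomp (j * d)%N) (val x)].

End VeroneseAlg.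

Section VeroneseMod.
Variables (k : fieldType) (S : gradedAlgType k) (M : gradedModType S).
Variables (d : nat) (d_gt0 : (0 < d)%N).

Definition veronese_mod_set : set M := internal_sum (fun j => mcomp (j * d%:Z)).

Let B0 j : mcomp (j * d%:Z) (0 : M). Proof. exact: mcomp0. Qed.
Let BB j (u v : M) :
  mcomp (j * d%:Z) u -> mcomp (j * d%:Z) v -> mcomp (j * d%:Z) (u - v).
Proof. exact: mcompB. Qed.

Lemma veronese_mod_setZ (a : S) (u : M) :
  veronese_alg_set d a -> veronese_mod_set u -> veronese_mod_set (a *: u).
Proof.
move=> [s [f [Wf ->]]] [t [g [Wg ->]]].
rewrite scaler_suml; apply: (internal_sum_big B0 BB) => i /=.
rewrite scaler_sumr; apply: (internal_sum_big B0 BB) => j /=.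
apply: (internal_sum_incl B0 BB (j := i%:Z + j)).
by rewrite mulrDl -PoszM; apply: mcompZ.
Qed.

Lemma veronese_zmod_closed : zmod_closed [in veronese_mod_set].
Proof.
split=> [|x y]; rewrite !inE; first exact: internal_sum0.
exact: (internal_sumB B0 BB).
Qed.

Definition veronese_mod of (0 < d)%N : Type := {x : M | [in veronese_mod_set] x}.

Local Notation Sd := (veronese_alg S d_gt0).
Local Notation Md := (veronese_mod d_gt0).

HB.instance Definition _ := [isSub of Md for @sval _ _].
HB.instance Definition _ := [Choice of Md by <:].
HB.instance Definition _ :=
  GRing.SubChoice_isSubZmodule.Build M [in veronese_mod_set] Md veronese_zmod_closed.

Fact veronese_scale_subproof (a : Sd) (u : Md) :
  val a *: val u \in veronese_mod_set.
Proof.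
by rewrite inE; apply: veronese_mod_setZ; apply: set_mem; [exact: (valP a)|exact: (valP u)].
Qed.

Definition veronese_scale (a : Sd) (u : Md) : Md :=
  Sub (val a *: val u) (veronese_scale_subproof a u).

Fact veronese_scaleA a b u :
  veronese_scale a (veronese_scale b u) = veronese_scale (a * b) u.
Proof. by apply: val_inj; rewrite !SubK scalerA. Qed.

Fact veronese_scale1 : left_id 1 veronese_scale.
Proof. by move=> u; apply: val_inj; rewrite SubK scale1r. Qed.

Fact veronese_scaleDr : right_distributive veronese_scale +%R.
Proof. by move=> a u v; apply: val_inj; rewrite raddfD !SubK scalerDr. Qed.

Fact veronese_scaleDl u : {morph veronese_scale^~ u : a b / a + b}.
Proof. by move=> a b; apply: val_inj; rewrite raddfD !SubK scalerDl. Qed.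

HB.instance Definition _ := GRing.Zmodule_isLmodule.Build Sd Md
  veronese_scaleA veronese_scale1 veronese_scaleDr veronese_scaleDl.

Definition veronese_mod_comp (j : int) : set Md :=
  [set u | mcomp (j * d%:Z) (val u)].

Fact veronese_mod_compB j u v : veronese_mod_comp j u -> veronese_mod_comp j v ->
  veronese_mod_comp j (u - v).
Proof. by rewrite /veronese_mod_comp /mkset raddfB; exact: mcompB. Qed.

Fact veronese_mod_comp0 j : veronese_mod_comp j 0.
Proof. by rewrite /veronese_mod_comp /mkset raddf0; exact: mcomp0. Qed.

Fact veronese_mod_compZ i j (a : Sd) (u : Md) :
  hcomp i a -> veronese_mod_comp j u -> veronese_mod_comp (i%:Z + j) (a *: u).
Proof.
rewrite /veronese_mod_comp /mkset SubK mulrDl -PoszM => ia ju.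
by apply: mcompZ => //; exact: ia.
Qed.

Fact veronese_mod_comp_sum : internal_sum veronese_mod_comp = [set: Md].
Proof.
rewrite -subTset => x _; have := valP x; rewrite inE => -[s [f [Wf xE]]].
have fP j : f j \in veronese_mod_set.
  by rewrite inE; exact: (internal_sum_incl B0 BB (j := j)).
exists s, (fun j => Sub (f j) (fP j) : Md); split=> [j|].
  by rewrite /veronese_mod_comp /mkset SubK.
by apply: val_inj; rewrite raddf_sum [LHS]xE.
Qed.

Fact veronese_mod_comp_indep : independent veronese_mod_comp.
Proof.
move=> s f us Wf s0 j js; apply: val_inj; rewrite raddf0.
have d0 : d%:Z != 0 by rewrite -lt0n.
have inj : injective (fun i : int => i * d%:Z) by exact: mulIf.
pose g (i : int) := if (d %| i)%Z then val (f (i %/ d)%Z) else 0.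
have gE i : g (i * d%:Z) = val (f i) by rewrite /g dvdz_mull // mulzK.
rewrite -gE.
apply: (@mcomp_indep k S M (map (fun i => i * d%:Z) s) g).
- by rewrite map_inj_uniq.
- move=> i; rewrite /g; case: ifP => [/dvdzP[a ->]|_]; last exact: mcomp0.
  by rewrite mulzK //; exact: Wf.
- rewrite big_map; under eq_bigr => i _ do rewrite gE.
  by rewrite -raddf_sum s0 raddf0.
- exact: map_f.
Qed.

HB.instance Definition _ := isGradedMod.Build k Sd Md veronese_mod_comp0
  veronese_mod_compB veronese_mod_compZ veronese_mod_comp_sum
  veronese_mod_comp_indep.

End VeroneseMod.

Arguments veronese_alg {k} S {d} d_gt0.
Arguments veronese_mod {k S} M {d} d_gt0.
Arguments veronese_ideal {k S d} d_gt0 I.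

(* Main.v *)
Require Import Defs.
From HB Require Import structures.
From mathcomp Require Import all_boot all_algebra.
From mathcomp Require Import boolp classical_sets.

Set Implicit Arguments.
Unset Strict Implicit.
Unset Printing Implicit Defensive.

Import GRing.Theory.
Local Open Scope classical_set_scope.
Local Open Scope ring_scope.

(** Write [Sd] and [Md] for the [d]-th Veronese subalgebra and module.  As an
    [Sd]-module, [S] is the direct sum of [Sd] and of the sum of the [S_i] with
    [d] not dividing [i]; let [pi : S -> Sd] be the resulting [Sd]-linear
    projection ([veronese_proj]).  For every [b : S] and every [S]-linear
    [phi : M -> S], the map [u |-> pi (b * phi u)] is then an [Sd]-linear map
    [Md -> Sd], so all its values lie in the trace of [Md]
    ([trace_veronese_proj]).  The linearity of [pi] takes the place of a
    decomposition of [phi] into homogeneous maps.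

    Next take [b] to be a product of [d - 1] elements of [S_1] and let [m] be
    homogeneous of degree [p].  Some [t] between [0] and [d - 1] satisfies
    [t + p = 0] modulo [d].  Split [b] as [b1 * b2] with [b1] the product of the
    first [t] factors: then [b1 *: m] lies in [Md], and
    [b * phi m = b2 * phi (b1 *: m)], so [pi (b * phi m)] is in the trace
    of [Md] ([trace_proj_products]).  This is where the exponent [d - 1] comes
    from: it is the largest shift needed to reach a multiple of [d].

    The elements [b] generate the [(d-1)]-st power of the ideal generated by
    [S_1] ([ideal_exp_gen]), and the elements [phi m] generate the trace of [M];
    hence [pi] maps the product of these ideals into the trace of [Md]
    ([trace_proj_ideal_mul]).  The theorem follows because [pi] is the identity
    on [Sd]. *)

(** * Splitting a direct sum along a set of degrees *)

(** Independence only speaks of sums over distinct indices, so repeated indices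
    have to be merged before it can be used; an index of multiplicity [n]
    contributes its summand [n] times. *)
Lemma internal_sum_uniq (J : eqType) (V : zmodType) (W : J -> set V) :
  (forall j, W j 0) -> (forall j u v, W j u -> W j v -> W j (u - v)) ->
  forall x, internal_sum W x ->
  exists s f, [/\ uniq s, forall j, W j (f j) & x = \sum_(j <- s) f j].
Proof.
move=> W0 WB x [s [f [Wf ->]]].
exists (undup s), (fun j => f j *+ count_mem j s).
split=> [|j|]; [exact: undup_uniq| |by rewrite -[LHS]big_undup_iterop_count].
elim: (count_mem j s) => [|n IHn]; first by rewrite mulr0n.
rewrite mulrS -[f j *+ n]opprK; apply: (WB) => //.
by rewrite -[- _]add0r; apply: (WB).
Qed.

Section PartialSums.
Variables (J : eqType) (V : zmodType) (W : J -> set V).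
Hypothesis W0 : forall j, W j 0.
Hypothesis WB : forall j u v, W j u -> W j v -> W j (u - v).

(** Pieces off [P] are made zero instead of being dropped: keeping [J] as the
    index type lets one family of degrees be compared with its complement. *)
Definition restrict_pieces (P : pred J) (j : J) : set V :=
  [set v | W j v /\ (~~ P j -> v = 0)].

Lemma restrict_pieces0 P j : restrict_pieces P j 0.
Proof. by split. Qed.

Lemma restrict_piecesB P j u v :
  restrict_pieces P j u -> restrict_pieces P j v -> restrict_pieces P j (u - v).
Proof.
move=> [Wu Pu] [Wv Pv]; split=> [|nPj]; first exact: WB.
by rewrite Pu // Pv // subr0.
Qed.

Lemma internal_sum_split (P : pred J) x : internal_sum W x ->
  exists2 y, internal_sum (restrict_pieces P) y
           & internal_sum (restrict_pieces (predC P)) (x - y).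
Proof.
move=> [s [f [Wf ->]]]; exists (\sum_(j <- s) if P j then f j else 0).
  exists s, (fun j => if P j then f j else 0); split=> // j.
  by case: ifPn => Pj; split=> //; rewrite Pj.
exists s, (fun j => f j - if P j then f j else 0); split=> [j|].
  by split=> /= [|/negPn->]; [apply: WB => //; case: ifP|rewrite subrr].
by rewrite sumrB.
Qed.

(** Subtracting an expression of [x] over indices off [P] from one over indices
    in [P] gives a relation between pieces with distinct indices, so independence
    makes every summand vanish. *)
Lemma internal_sum_disjoint (P : pred J) x : independent W ->
  internal_sum (restrict_pieces P) x ->
  internal_sum (restrict_pieces (predC P)) x -> x = 0.
Proof.
move=> indep.
have supp Q y : internal_sum (restrict_pieces Q) y -> exists s f,
    [/\ uniq s, all Q s, forall j, W j (f j) & y = \sum_(j <- s) f j].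
  move=> /(internal_sum_uniq (@restrict_pieces0 Q) (@restrict_piecesB Q)).
  move=> [s [f [us Wf ->]]].
  exists (filter Q s), f; rewrite filter_uniq // filter_all.
  split=> // [j|]; first by case: (Wf j).
  rewrite big_filter [RHS]big_mkcond; apply: eq_bigr => j _.
  by case: ifPn => // /(proj2 (Wf j)).
move=> /supp[s [f [us Ps Wf xs]]] /supp[t [g [ut Pt Wg xt]]].
(* The coefficients of the relation [x - x = 0] over the disjoint union of [s] and [t]. *)
pose h j := if P j then f j else - g j.
have hs : \sum_(j <- s) h j = x.
  rewrite xs big_seq [RHS]big_seq; apply: eq_bigr => j /(allP Ps) Pj.
  by rewrite /h Pj.
have ht : \sum_(j <- t) h j = - x.
  rewrite xt -sumrN big_seq [RHS]big_seq; apply: eq_bigr => j /(allP Pt) /= Pj.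
  by rewrite /h (negPf Pj).
rewrite -hs big_seq big1 // => j js; apply: (indep (s ++ t)).
- rewrite cat_uniq us ut andbT /=; apply/hasPn => i it.
  by apply/negP => /(allP Ps); apply/negP/(allP Pt).
- move=> i; rewrite /h; case: ifP => // _.
  by rewrite -[- _]add0r; apply: WB.
- by rewrite big_cat /= hs ht subrr.
- by rewrite mem_cat js.
Qed.

End PartialSums.

(** * Traces and powers of ideals *)

Section TraceTheory.
Variables (R : pzRingType) (V : lmodType R).

Lemma trace0 : trace V 0.
Proof. by exists [::]; rewrite big_nil. Qed.

Lemma traceD x y : trace V x -> trace V y -> trace V (x + y).
Proof. by move=> [s ->] [t ->]; exists (s ++ t); rewrite big_cat. Qed.

Lemma trace_app (f : {scalar V}) v : trace V (f v).
Proof. by exists [:: (f, v)]; rewrite big_seq1. Qed.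

End TraceTheory.

Section IdealTheory.
Variable R : comPzRingType.
Implicit Types (A I J : set R).

Lemma is_idealP I :
  I 0 -> (forall x y, I x -> I y -> I (x + y)) ->
  (forall a x, I x -> I (a * x)) -> is_ideal I.
Proof.
move=> I0 ID IM; split=> [|a x y]; rewrite !inE // => Ix Iy.
by apply: ID => //; apply: IM.
Qed.

Lemma ideal_gen_sub A I : is_ideal I -> A `<=` I -> ideal_gen A `<=` I.
Proof. by move=> idI AI; apply: smallest_sub. Qed.

Lemma ideal_gen_ideal A : is_ideal (ideal_gen A).
Proof.
split=> [|a x y]; rewrite !inE; first by move=> I [[I0 _] _]; rewrite inE in I0.
move=> Ax Ay I [idI AI]; have [I0 Ilin] := idI.
have := Ilin a x y; rewrite !inE; apply; [exact: Ax|exact: Ay].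
Qed.

Lemma ideal0 I : is_ideal I -> I 0.
Proof. by case; rewrite inE. Qed.

Lemma idealD I x y : is_ideal I -> I x -> I y -> I (x + y).
Proof.
by move=> [_ Ilin] Ix Iy; have := Ilin 1 x y; rewrite scale1r !inE; apply.
Qed.

Lemma idealM I a x : is_ideal I -> I x -> I (a * x).
Proof.
move=> idI Ix; have [_ Ilin] := idI; have := Ilin a x 0.
by rewrite addr0 !inE; apply => //; apply: ideal0.
Qed.

Definition products (A : set R) (n : nat) : set R :=
  [set x | exists s : seq R, [/\ size s = n, forall a, a \in s -> A a
                                & x = \prod_(a <- s) a]].

(** Multiplication is bilinear, so it suffices to multiply generators: for fixed
    [y] the multipliers [a] sending [y] into an ideal form an ideal, and the same
    holds with the two factors exchanged. *)
Lemma ideal_exp_gen A n : ideal_exp (ideal_gen A) n `<=` ideal_gen (products A n).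
Proof.
elim: n => [|n IHn] /= x.
  move=> _ I [idI AI]; rewrite -[x]mulr1; apply: (idealM _ idI).
  by apply: AI; exists [::]; rewrite big_nil.
apply: ideal_gen_sub; first exact: ideal_gen_ideal.
move=> _ [a [y [Aa /IHn ny ->]]].
pose G := ideal_gen (products A n.+1).
have idG : is_ideal G by exact: ideal_gen_ideal.
suff: [set a | forall y, ideal_gen (products A n) y -> G (a * y)] a by apply.
apply: (ideal_gen_sub _ _ Aa).
  apply: is_idealP => [z _|u v Gu Gv z nz|u v Gv z nz].
  - by rewrite mul0r; apply: ideal0.
  - by rewrite mulrDl; apply: (idealD idG); [apply: Gu|apply: Gv].
  - by rewrite -mulrA; apply: (idealM _ idG); apply: Gv.
move=> {y ny Aa} {}a Aa y ny.
suff: [set y | G (a * y)] y by [].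
apply: (ideal_gen_sub _ _ ny).
  apply: is_idealP => [|u v Gu Gv|u v Gv] /=.
  - by rewrite mulr0; apply: ideal0.
  - by rewrite mulrDr; apply: (idealD idG).
  - by rewrite mulrCA; apply: (idealM _ idG).
move=> {ny} _ [s [sn As ->]] I [_]; apply; exists (a :: s).
split; rewrite ?big_cons //= ?sn // => b.
by rewrite inE => /predU1P[->|/As].
Qed.

End IdealTheory.

(** * The projection onto the Veronese subalgebra *)

Section Projection.
Variables (k : fieldType) (S : gradedAlgType k) (d : nat) (d_gt0 : (0 < d)%N).
Local Notation Sd := (veronese_alg S d_gt0).

Let hc0 i : hcomp i (0 : S) := hcomp0 i.
Let hcB i (x y : S) : hcomp i x -> hcomp i y -> hcomp i (x - y) := @hcompB k S i x y.

Definition off_veronese : set S :=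
  internal_sum (restrict_pieces hcomp (predC (dvdn d))).

Lemma veronese_alg_setE :
  veronese_alg_set d = internal_sum (restrict_pieces (@hcomp k S) (dvdn d)).
Proof.
have B0 j : hcomp (j * d)%N (0 : S) by [].
have BB j (u v : S) :
  hcomp (j * d)%N u -> hcomp (j * d)%N v -> hcomp (j * d)%N (u - v) by exact: hcB.
rewrite eqEsubset; split=> x [s [f [Wf ->]]].
  apply: internal_sum_seq (fun j => (j * d)%N) _ _ => [i|i u v|j].
  - exact: restrict_pieces0.
  - exact: restrict_piecesB.
  - by split=> //; rewrite dvdn_mull.
apply: (internal_sum_big B0 BB) => i.
case: (Wf i) => fi; case: (boolP (d %| i)%N) => [/dvdnP[j ij] _|_ ->] //.
  by apply: (internal_sum_incl B0 BB (j := j)); rewrite -ij.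
exact: internal_sum0.
Qed.

Lemma off_veroneseB x y :
  off_veronese x -> off_veronese y -> off_veronese (x - y).
Proof.
by apply: internal_sumB => [i|i u v];
  [exact: restrict_pieces0 | exact: restrict_piecesB].
Qed.

(** This stability is what makes the projection linear over the Veronese
    subalgebra: adding a multiple of [d] to a degree does not change whether [d]
    divides it. *)
Lemma off_veroneseM a x :
  veronese_alg_set d a -> off_veronese x -> off_veronese (a * x).
Proof.
have O0 i : restrict_pieces (@hcomp k S) (predC (dvdn d)) i 0.
  exact: restrict_pieces0.
have OB i u v : restrict_pieces (@hcomp k S) (predC (dvdn d)) i u ->
    restrict_pieces hcomp (predC (dvdn d)) i v ->
    restrict_pieces hcomp (predC (dvdn d)) i (u - v).
  exact: restrict_piecesB.
move=> [s [f [Wf ->]]] [t [g [Wg ->]]].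
rewrite big_distrl; apply: (internal_sum_big O0 OB) => j /=.
rewrite big_distrr; apply: (internal_sum_big O0 OB) => i /=.
have [gi gi0] := Wg i.
apply: (internal_sum_incl O0 OB (j := (j * d + i)%N)); split.
  exact: hcompM.
by rewrite /= dvdn_addr ?dvdn_mull // => /gi0->; rewrite mulr0.
Qed.

Lemma veronese_proj_exists (x : S) : exists a : Sd, off_veronese (x - val a).
Proof.
have : internal_sum (@hcomp k S) x by rewrite hcomp_sum.
move=> /(internal_sum_split hc0 hcB (dvdn d))[a]; rewrite -veronese_alg_setE => Va xa.
by exists (Sub a (mem_set Va)); rewrite SubK.
Qed.

Definition veronese_proj (x : S) : Sd := projT1 (cid (veronese_proj_exists x)).

Lemma veronese_projP x : off_veronese (x - val (veronese_proj x)).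
Proof. by rewrite /veronese_proj; case: cid. Qed.

Lemma veronese_proj_unique x (a : Sd) :
  off_veronese (x - val a) -> veronese_proj x = a.
Proof.
move=> xa; apply/eqP; rewrite -subr_eq0; apply/eqP/val_inj; rewrite raddf0.
apply: (internal_sum_disjoint hc0 hcB (P := dvdn d)); first exact: hcomp_indep.
  by rewrite -veronese_alg_setE; apply: set_mem; exact: valP.
have -> : val (veronese_proj x - a) = (x - val a) - (x - val (veronese_proj x)).
  by rewrite raddfB opprB [RHS]addrC addrA subrK.
by apply: off_veroneseB => //; exact: veronese_projP.
Qed.

Lemma veronese_projB : zmod_morphism veronese_proj.
Proof.
move=> x y; apply: veronese_proj_unique; rewrite [\val _]raddfB.
by rewrite opprD addrACA -opprD; apply: off_veroneseB; exact: veronese_projP.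
Qed.

HB.instance Definition _ :=
  GRing.isZmodMorphism.Build S Sd veronese_proj veronese_projB.

Lemma veronese_projM (a : Sd) x : veronese_proj (val a * x) = a * veronese_proj x.
Proof.
apply: veronese_proj_unique; rewrite rmorphM -mulrBr.
by apply: off_veroneseM; [apply: set_mem; exact: valP|exact: veronese_projP].
Qed.

Lemma veronese_proj_val (a : Sd) : veronese_proj (val a) = a.
Proof.
by apply: veronese_proj_unique; rewrite subrr; exact: internal_sum0.
Qed.

End Projection.

(** * The trace of the Veronese module *)

Section VeroneseTrace.
Variables (k : fieldType) (S : gradedAlgType k) (M : gradedModType S).
Variables (d : nat) (d_gt0 : (0 < d)%N).
Local Notation Sd := (veronese_alg S d_gt0).
Local Notation Md := (veronese_mod M d_gt0).
Local Notation proj := (veronese_proj d_gt0).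

Section Induced.
Variables (b : S) (phi : {scalar M}).

Definition veronese_form (u : Md) : Sd := proj (b * phi (val u)).

Fact veronese_form_zmod : zmod_morphism veronese_form.
Proof.
move=> u v; rewrite /veronese_form [\val _]raddfB [phi _]raddfB mulrBr.
exact: raddfB.
Qed.

HB.instance Definition _ :=
  GRing.isZmodMorphism.Build Md Sd veronese_form veronese_form_zmod.

Fact veronese_form_scalar : scalable_for *%R veronese_form.
Proof.
move=> a u; rewrite /veronese_form SubK scalarZ mulrCA.
exact: veronese_projM.
Qed.

HB.instance Definition _ :=
  GRing.isScalable.Build Sd Md Sd *%R veronese_form veronese_form_scalar.

End Induced.

Lemma trace_veronese_proj (b : S) (phi : {scalar M}) (u : M) :
  veronese_mod_set d u -> trace (R := Sd) Md (proj (b * phi u)).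
Proof.
move=> /mem_set Vu.
exact: (trace_app (veronese_form b phi : {scalar Md}) (Sub u Vu)).
Qed.

Lemma hcomp_prod (s : seq S) : (forall a, a \in s -> hcomp 1 a) ->
  hcomp (size s) (\prod_(a <- s) a).
Proof.
elim: s => [|a s IHs] s1; first by rewrite big_nil; exact: hcomp1.
rewrite big_cons /= -add1n; apply: hcompM; first by apply: s1; exact: mem_head.
by apply: IHs => c cs; apply: s1; rewrite inE cs orbT.
Qed.

(** For homogeneous [m], just enough factors of [b] are moved inside [phi] to
    bring [m] to a degree divisible by [d]; [d - 1] factors always suffice. *)
Lemma trace_proj_products (b : S) (phi : {scalar M}) (m : M) :
  products (hcomp 1) (d - 1) b -> trace (R := Sd) Md (proj (b * phi m)).
Proof.
move=> [s [sd s1 ->]].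
have : internal_sum (@mcomp k S M) m by rewrite mcomp_sum.
move=> [r [f [Wf ->]]]; rewrite raddf_sum mulr_sumr raddf_sum.
apply: big_ind => [||p _]; [exact: trace0|exact: traceD|].
have d0 : d%:Z != 0 by rewrite -lt0n.
(* The number of factors to move: the residue of [- p], computed in [int] since
   [p] may be negative. *)
pose t := `|(- p %% d%:Z)%Z|%N.
have tE : t%:Z = (- p %% d%:Z)%Z by rewrite gez0_abs // modz_ge0.
have td : (t <= d - 1)%N.
  by rewrite -ltnS subn1 prednK // -ltz_nat tE ltz_pmod.
rewrite -{1}(cat_take_drop t s) big_cat /= mulrAC -scalarZ mulrC.
apply: trace_veronese_proj.
apply: (@internal_sum_incl _ _ _ _ _ ((t%:Z + p) %/ d%:Z)%Z) => [j|j u v|].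
- exact: mcomp0.
- exact: mcompB.
rewrite divzK; last first.
  by apply/dvdz_mod0P; rewrite tE modzDml addNr mod0z.
apply: mcompZ => //.
have {1}-> : t = size (take t s) by rewrite size_takel // sd.
by apply: hcomp_prod => a /mem_take; exact: s1.
Qed.

(** The projection is only linear over the Veronese subalgebra, so the preimage of
    the trace under it need not be an ideal of [S].  The largest ideal inside that preimage, called [T] below, is
    used instead; membership in [T] then only has to be tested on generators. *)
Lemma trace_proj_ideal_mul (I : set S) : I `<=` trace M ->
  ideal_mul (ideal_exp (ideal_gen (hcomp 1)) (d - 1)) I `<=`
    [set z | trace (R := Sd) Md (proj z)].
Proof.
move=> Itr z nz.
pose T := [set z | forall a, trace (R := Sd) Md (proj (a * z))].
suff /(_ 1) : T z by rewrite mul1r.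
apply: (ideal_gen_sub _ _ nz).
  apply: is_idealP => [a|x y Tx Ty a|c x Tx a].
  - by rewrite mulr0 raddf0; exact: trace0.
  - by rewrite mulrDr raddfD; apply: traceD; [apply: Tx|apply: Ty].
  - by rewrite mulrA; exact: Tx.
move=> {nz} _ [x [y [/ideal_exp_gen nx /Itr[s ->] ->]]] a.
rewrite mulrA mulr_sumr raddf_sum.
apply: big_ind => [||[phi m] _ /=]; [exact: trace0|exact: traceD|].
suff: [set x | forall m, trace (R := Sd) Md (proj (x * phi m))] x.
  (* The arbitrary multiplier [a] is absorbed into [m]. *)
  by move=> /(_ (a *: m)); rewrite scalarZ mulrA [x * a]mulrC.
apply: (ideal_gen_sub _ _ nx) => [|b bP m']; last exact: trace_proj_products.
apply: is_idealP => [u|v w Tv Tw u|c v Tv u].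
- by rewrite mul0r raddf0; exact: trace0.
- by rewrite mulrDl raddfD; apply: traceD; [apply: Tv|apply: Tw].
- by rewrite [c * v]mulrC -mulrA -scalarZ; exact: Tv.
Qed.

End VeroneseTrace.

Theorem proposition3p1 (k : fieldType) (S : gradedAlgType k)
    (S_noetherian : noetherian S)
    (S0_finite_dim : finitely_generated k (hcomp 0%N : set (kspace S)))
    (M : gradedModType S) (M_finite : finitely_generated S [set: M])
    (I : set S) (I_graded : graded_ideal I) (I_sub_trace : I `<=` trace M)
    (d : nat) (d_gt0 : (1 <= d)%N) :
  let n := ideal_gen (hcomp 1%N : set S) in
  veronese_ideal d_gt0 (ideal_mul (ideal_exp n (d - 1)) I)
    `<=` trace (R := veronese_alg S d_gt0) (veronese_mod M d_gt0).
Proof.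
move=> n x [s [f [nf xE]]].
rewrite -(veronese_proj_val x) xE raddf_sum.
apply: big_ind => [||j _]; [exact: trace0|exact: traceD|].
by apply: (trace_proj_ideal_mul d_gt0 I_sub_trace); case: (nf j).
Qed.
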